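(* For any $n\ge1$, $$C_n(-1,q)=\sum_{\pi\in\mathfrak{S}_n(321)}(-1)^{\mathsf{exc}\,\pi}q^{\mathsf{inv}\,\pi-\mathsf{exc}\,\pi}=\begin{cases}0,& n\text{ even},\\ (-q)^{(n-1)/2}C_{(n-1)/2}(q^2),& n\text{ odd},\end{cases}$$ and $$\sum_{\pi\in\mathfrak{D}_n(321)}(-1)^{\mathsf{exc}\,\pi}q^{\mathsf{inv}\,\pi}=\begin{cases}(-q)^{n/2}C_{n/2}(q^2),& n\text{ even},\\ 0,& n\text{ odd}.\end{cases}$$
   Context: $C_n(t,q)$ is defined by $\sum_{n\ge0}C_n(t,q)z^n=1/(1-c_1z/(1-c_2z/(1-c_3z/\cdots)))$ with $c_{2k-1}=q^{k-1}$, $c_{2k}=tq^{k-1}$; Carlitz's $q$-Catalan numbers are $C_n(q):=C_n(q,q^2)$. $\mathfrak{S}_n(321)$: permutations of $[n]$ avoiding $321$; $\mathfrak{D}_n(321)$: those among them with no fixed point. $\mathsf{exc}\,\pi=\#\{i:\pi(i)>i\}$, $\mathsf{inv}\,\pi=\#\{i<j:\pi(i)>\pi(j)\}$. *)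

(* Defs.v *)
From HB Require Import structures.
From mathcomp Require Import all_boot all_order all_algebra all_fingroup.
Set Implicit Arguments. Unset Strict Implicit. Unset Printing Implicit Defensive.
Import GRing.Theory.
Local Open Scope ring_scope.

(* Continued-fraction coefficients c_j (j >= 1):
   c_{2k-1} = q^(k-1), c_{2k} = t q^(k-1). *)
Definition cfc (R : comNzRingType) (t q : R) (j : nat) : R :=
  if odd j then q ^+ j./2 else t * q ^+ (j./2).-1.

(* G_j(z) = 1/(1 - c_j z/(1 - c_{j+1} z/ ...)) satisfies
   G_j = 1 + c_j z G_{j+1} G_j, hence its coefficients g_n(j) satisfy
   g_0(j) = 1, g_{n+1}(j) = sum_{k<=n} c_j g_k(j+1) g_{n-k}(j).
   cf_table t q n = [:: g_0; ...; g_n]. *)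
Fixpoint cf_table (R : comNzRingType) (t q : R) (n : nat) : seq (nat -> R) :=
  match n with
  | 0 => [:: fun _ => 1]
  | m.+1 =>
      let tb := cf_table t q m in
      rcons tb (fun j => \sum_(k < m.+1)
                  cfc t q j * nth (fun _ => 0) tb k j.+1
                            * nth (fun _ => 0) tb (m - k)%N j)
  end.

(* C_n(t,q) = [z^n] G_1(z). *)
Definition Ctq (R : comNzRingType) (t q : R) (n : nat) : R :=
  nth (fun _ => 0) (cf_table t q n) n 1%N.

Definition Carlitz (R : comNzRingType) (q : R) (n : nat) : R := Ctq q (q ^+ 2) n.

Definition avoids321 (n : nat) (s : 'S_n) : bool :=
  [forall i : 'I_n, forall j : 'I_n, forall k : 'I_n,
     ~~ [&& (i < j)%N, (j < k)%N, (s i > s j)%N & (s j > s k)%N]].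

Definition derangement (n : nat) (s : 'S_n) : bool := [forall i : 'I_n, s i != i].

Definition excnum (n : nat) (s : 'S_n) : nat := #|[set i : 'I_n | (i < s i)%N]|.

Definition invnum (n : nat) (s : 'S_n) : nat :=
  #|[set p : 'I_n * 'I_n | (p.1 < p.2)%N && (s p.2 < s p.1)%N]|.

(* Main.v *)
Require Import Defs.
From HB Require Import structures.
From mathcomp Require Import all_boot all_order all_algebra all_fingroup.
From mathcomp Require Import zify ring.
Set Implicit Arguments. Unset Strict Implicit. Unset Printing Implicit Defensive.
Import GRing.Theory.

(** In a 321-avoiding permutation every inversion goes from an excedance to an
    anti-excedance, so the permutation is increasing on its excedance positions
    and on the remaining ones, and is determined by its sets of excedance
    positions and of excedance values.  Reading both indicators from left to
    right gives a Motzkin path with two kinds of level steps off the axis, whose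
    height after step [i] is #{a <= i < s a}; the inversion number is the sum of
    the heights, and fixed points are the level steps on the axis.  Level steps
    off the axis cancel for the signed derangement weights, leaving Dyck paths
    with up-down weights [-q^(2h+1)], which is Carlitz' continued fraction in
    [q^2].  The full sum is the even contraction of the fraction defining [Ctq];
    at [t = -1] its odd contraction has no level steps and the same weights
    [-q^(2h+1)]. *)

Lemma ltn_card_exists (T : finType) (A B : {set T}) :
  #|A| < #|B| -> exists2 x, x \in B & x \notin A.
Proof.
move=> ltAB; apply/subsetPn; apply: contraL ltAB => /subset_leq_card.
by rewrite -leqNgt.
Qed.

Lemma card_set_sum (T : finType) (P : pred T) : #|[set x | P x]| = \sum_x P x.
Proof. by rewrite -sum1dep_card big_mkcond. Qed.

Lemma card_ord_ltn n m : m <= n -> #|[set k : 'I_n | k < m]| = m.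
Proof.
by move=> lemn; rewrite -sum1dep_card -(big_ord_widen _ (fun=> 1)) // sum1_card card_ord.
Qed.

Lemma card_ord_itv n a b : b <= n -> #|[set i : 'I_n | a <= i < b]| = b - a.
Proof.
move=> lebn; have [leab|ltba] := leqP a b; last first.
  rewrite (eqnP (ltnW ltba)); apply: eq_card0 => i; rewrite inE.
  by apply/negP => /andP[]; lia.
rewrite -{2}(card_ord_ltn lebn) -{2}(card_ord_ltn (leq_trans leab lebn)) -cardsDS.
  by apply: eq_card => i; rewrite !inE -leqNgt.
by apply/subsetP => i; rewrite !inE => /leq_trans; apply.
Qed.

Lemma card_perm_ltn n (s : 'S_n) m : m <= n -> #|[set k | s k < m]| = m.
Proof.
move=> lemn; rewrite -[RHS](card_ord_ltn lemn) -[LHS](card_imset _ (@perm_inj _ s)).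
by apply: eq_card => v; rewrite -(permKV s v) mem_imset ?inE //; apply: perm_inj.
Qed.

Section CountBelow.
Variable n : nat.
Implicit Types P : pred 'I_n.

Definition count_below P m := #|[set v : 'I_n | P v && (v < m)]|.

Lemma count_below0 P : count_below P 0 = 0.
Proof. by apply: eq_card0 => v; rewrite inE ltn0 andbF. Qed.

Lemma count_belowS P (v : 'I_n) : count_below P v.+1 = count_below P v + P v.
Proof.
rewrite /count_below (cardsD1 v) inE ltnSn andbT addnC; congr (_ + _).
apply: eq_card => u; rewrite !inE -val_eqE /=.
by case: (P u); lia.
Qed.

Lemma eq_count_below P P' m : P =1 P' -> count_below P m = count_below P' m.
Proof. by move=> eqPP'; apply: eq_card => v; rewrite !inE eqPP'. Qed.

Lemma count_belowC P m : m <= n -> count_below P m + count_below (predC P) m = m.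
Proof.
elim: m => [|m IHm] ltmn; first by rewrite !count_below0.
rewrite !(count_belowS _ (Ordinal ltmn)) /= addnACA IHm; last exact: ltnW.
by case: (P _); rewrite addn1.
Qed.

Lemma leq_count_below P m k : m <= k -> count_below P m <= count_below P k.
Proof.
move=> lemk; apply/subset_leq_card/subsetP => v; rewrite !inE => /andP[-> /=].
by move/leq_trans; apply.
Qed.

Lemma ltn_count_below P (u : 'I_n) m :
  P u -> u < m -> count_below P u < count_below P m.
Proof.
move=> Pu ltum; apply: leq_trans (leq_count_below P ltum).
by rewrite count_belowS Pu addn1.
Qed.

Lemma count_below_inj P (u v : 'I_n) :
  P u -> P v -> count_below P u = count_below P v -> u = v.
Proof.
move=> Pu Pv eqc; apply: val_inj; case: (ltngtP u v) => // lt.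
  by have := ltn_count_below Pu lt; rewrite eqc ltnn.
by have := ltn_count_below Pv lt; rewrite eqc ltnn.
Qed.

Lemma count_below_surj P m k : m <= n -> k < count_below P m ->
  exists2 v : 'I_n, P v & count_below P v = k.
Proof.
elim: m => [|m IHm] ltmn; first by rewrite count_below0.
rewrite (count_belowS _ (Ordinal ltmn)) /=.
have [ltk _|lek] := ltnP k (count_below P m); first exact: IHm (ltnW ltmn) ltk.
by move=> ltk; exists (Ordinal ltmn); case: (P _) ltk => //=; lia.
Qed.

End CountBelow.

Section ColourIncreasing.
Variables (n : nat) (T : eqType).
Implicit Types (a b : 'I_n -> T) (s : 'S_n).

Definition colour_increasing a s := forall i j : 'I_n, i < j -> a i = a j -> s i < s j.

Definition colour_count a x m := count_below (fun v => a v == x) m.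

Lemma colour_count_perm a b s i :
  (forall j, b (s j) = a j) -> colour_increasing a s ->
  colour_count b (a i) (s i) = colour_count a (a i) i.
Proof.
move=> bs incr; rewrite /colour_count /count_below -[RHS](card_imset _ (@perm_inj _ s)).
apply: eq_card => v; rewrite -(permKV s v); set j := s^-1%g v.
rewrite mem_imset ?inE ?bs; last exact: perm_inj.
case: eqP => //= eqa; case: (ltngtP j i) => [lt|lt|/val_inj->]; last by rewrite ltnn.
  exact: incr.
by apply/negbTE; rewrite -leqNgt ltnW // incr.
Qed.

Lemma colour_increasing_inj a b s s' :
  (forall i, b (s i) = a i) -> (forall i, b (s' i) = a i) ->
  colour_increasing a s -> colour_increasing a s' -> s = s'.
Proof.
move=> bs bs' incr incr'; apply/permP => i.
apply: (@count_below_inj _ (fun v => b v == a i)); rewrite ?bs ?bs' //.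
by rewrite -!/(colour_count _ _ _) !colour_count_perm.
Qed.

Lemma colour_increasing_exists a b :
  (forall x, colour_count a x n = colour_count b x n) ->
  exists2 s : 'S_n, forall i, b (s i) = a i & colour_increasing a s.
Proof.
move=> eqab.
have same_rank i : exists v,
    (b v == a i) && (colour_count b (a i) v == colour_count a (a i) i).
  have ltn_rank : colour_count a (a i) i < colour_count b (a i) n.
    by rewrite -eqab; apply: ltn_count_below.
  have [v bv rank_v] := count_below_surj (leqnn n) ltn_rank.
  by exists v; rewrite bv; apply/eqP.
pose f i := xchoose (same_rank i).
have bf i : b (f i) = a i by have /andP[/eqP] := xchooseP (same_rank i).
have rank_f i : colour_count b (a i) (f i) = colour_count a (a i) i.
  by have /andP[_ /eqP] := xchooseP (same_rank i).
have f_inj : injective f.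
  move=> i j eqf; have eqa : a i = a j by rewrite -!bf eqf.
  apply: (@count_below_inj _ (fun v => a v == a i)); rewrite ?eqa //.
  by rewrite -!/(colour_count _ _ _) -rank_f -eqa -rank_f eqf eqa.
exists (perm f_inj) => [i|i j ltij eqa]; rewrite !permE //.
have: colour_count a (a i) i < colour_count a (a i) j by apply: ltn_count_below.
rewrite {2}eqa -!rank_f -eqa ltnNge; apply: contraR; rewrite -leqNgt.
exact: leq_count_below.
Qed.

End ColourIncreasing.

Lemma colour_count_bool n (c : pred 'I_n) e m : m <= n ->
  colour_count c e m = if e then count_below c m else m - count_below c m.
Proof.
move=> lemn; case: e; first by apply: eq_count_below => v; case: (c v).
rewrite -{2}(count_belowC c lemn) addKn.
by apply: eq_count_below => v /=; case: (c v).
Qed.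

Section Avoiding321.
Variable n : nat.
Implicit Types (s : 'S_n) (i j k : 'I_n).

Definition excpos s : pred 'I_n := fun i => i < s i.
Definition excval s : pred 'I_n := fun v => s^-1%g v < v.
Definition fixnum s := #|[set i | s i == i]|.

Lemma excval_perm s i : excval s (s i) = excpos s i.
Proof. by rewrite /excval permK. Qed.

Lemma excnum_sum s : excnum s = \sum_i excpos s i.
Proof. exact: card_set_sum. Qed.

Lemma derangement_fixnum s : derangement s = (fixnum s == 0).
Proof.
rewrite cards_eq0; apply/forallP/eqP => [ds | fix0 i].
  by apply/setP => i; rewrite !inE (negPf (ds i)).
by have := in_set0 i; rewrite -fix0 inE => ->.
Qed.

Lemma perm_ltnNge s i j : i < j -> (s i < s j) = ~~ (s j < s i).
Proof.
rewrite -leqNgt [RHS]leq_eqVlt => ltij.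
by case: eqP => [/val_inj/perm_inj eqij|//]; rewrite eqij ltnn in ltij.
Qed.

Lemma avoids321_leq s i j k : avoids321 s ->
  i < j -> j < k -> s j < s i -> s j <= s k.
Proof.
move=> av ltij ltjk ltji; move/forallP/(_ i)/forallP/(_ j)/forallP/(_ k): av.
by rewrite ltij ltjk ltji -leqNgt.
Qed.

(* Otherwise [j] and the positions up to [i] do not fit into the values up to
   [s i], so a position before [i] has a larger value. *)
Lemma avoids321_inversion_excpos s i j : avoids321 s ->
  i < j -> s j < s i -> i < s i.
Proof.
move=> av ltij ltji; rewrite ltnNge; apply/negP => lesi.
have [|k] := @ltn_card_exists _ [set k | s k < (s i).+1] (j |: [set k : 'I_n | k < i.+1]).
  by rewrite cardsU1 card_perm_ltn // card_ord_ltn // !inE ltnS -ltnNge ltij; lia.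
rewrite !inE -leqNgt !ltnS => /predU1P[->|leki ltik]; first by lia.
case: (ltngtP k i) leki => // [ltki _|/val_inj eqki]; last by rewrite eqki ltnn in ltik.
by have := avoids321_leq av ltki ltij ltik; rewrite leqNgt ltji.
Qed.

(* Otherwise the values below [s j] do not fit into the positions before [j]
   other than [i], so a position after [j] has a smaller value. *)
Lemma avoids321_inversion_antiexc s i j : avoids321 s ->
  i < j -> s j < s i -> s j < j.
Proof.
move=> av ltij ltji; rewrite ltnNge; apply/negP => lej.
have [|k] := @ltn_card_exists _ ([set k : 'I_n | k < j] :\ i) [set k | s k < s j].
  have := cardsD1 i [set k : 'I_n | k < j].
  by rewrite inE ltij card_perm_ltn ?card_ord_ltn ?(ltnW (ltn_ord _)) //; lia.
rewrite !inE negb_and negbK -leqNgt => ltkj /predU1P[eqki|lejk].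
  by rewrite eqki ltnNge ltnW in ltkj.
case: (ltngtP j k) lejk => // [ltjk _|/val_inj eqjk]; last by rewrite eqjk ltnn in ltkj.
by have := avoids321_leq av ltij ltjk ltji; rewrite leqNgt ltkj.
Qed.

Lemma avoids321P s : reflect (colour_increasing (excpos s) s) (avoids321 s).
Proof.
apply: (iffP idP) => [av i j ltij eqexc | incr].
  rewrite perm_ltnNge //; apply/negP => ltji; move: eqexc; rewrite /excpos.
  have := avoids321_inversion_excpos av ltij ltji.
  by have := avoids321_inversion_antiexc av ltij ltji; lia.
apply/forallP => i; apply/forallP => j; apply/forallP => k.
apply/negP => /and4P[ltij ltjk ltji ltkj].
have := incr i j ltij; have := incr j k ltjk; have := incr i k (ltn_trans ltij ltjk).
by case: (excpos s i); case: (excpos s j); case: (excpos s k); lia.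
Qed.

Definition perm_height s m := #|[set a : 'I_n | a < m <= s a]|.

Lemma perm_height0 s : perm_height s 0 = 0.
Proof. by apply: eq_card0 => a; rewrite inE ltn0. Qed.

Lemma perm_height_max s : perm_height s n = 0.
Proof. by apply: eq_card0 => a; rewrite inE [n <= _]leqNgt !ltn_ord. Qed.

Lemma perm_heightS s i : perm_height s i.+1 + excval s i = perm_height s i + excpos s i.
Proof.
rewrite /perm_height (cardsD1 i) [in RHS](cardsD1 (s^-1%g i)) !inE permKV !leqnn.
rewrite andbT /= addnC addnA addnAC; congr (_ + _); congr (_ + _).
apply: eq_card => a; rewrite !inE -(inj_eq (@perm_inj _ s) a) permKV -!val_eqE /=.
by lia.
Qed.

Lemma excval_height_gt0 s i : excval s i -> 0 < perm_height s i.
Proof. by move=> ev; apply/card_gt0P; exists (s^-1%g i); rewrite inE permKV leqnn andbT. Qed.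

Lemma excpos_le_heightS s i : excpos s i <= perm_height s i.+1.
Proof.
have := perm_heightS s i; have := @excval_height_gt0 s i.
by case: (excpos s i); case: (excval s i) => //= gt0; lia.
Qed.

Lemma fixed_height s i : avoids321 s ->
  (s i == i) = [&& ~~ excpos s i, ~~ excval s i & perm_height s i == 0].
Proof.
move=> av; apply/eqP/and3P => [si | [npos _ /eqP height0]].
  have siV : s^-1%g i = i by rewrite -[in LHS]si permK.
  rewrite /excpos /excval si siV ltnn; split=> //.
  apply: contraT; rewrite -lt0n => /card_gt0P[a]; rewrite inE => /andP[ltai leia].
  have ltsa : s i < s a by rewrite -[_ < _]negbK -perm_ltnNge // si -leqNgt.
  by have := avoids321_inversion_antiexc av ltai ltsa; rewrite si ltnn.
apply: val_inj => /=; apply/eqP; rewrite eqn_leq leqNgt npos /= leqNgt.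
apply/negP => ltsi.
have [|k] := @ltn_card_exists _ [set k | s k < i] [set k : 'I_n | k < i.+1].
  by rewrite card_perm_ltn ?card_ord_ltn // ltnW.
rewrite !inE -leqNgt ltnS leq_eqVlt => /predU1P[/val_inj->|ltki leik]; first by lia.
suff: 0 < perm_height s i by rewrite height0.
by apply/card_gt0P; exists k; rewrite inE ltki.
Qed.

Lemma sum_perm_height s : \sum_(i < n) perm_height s i.+1 = \sum_(i < n) (s i - i).
Proof.
under eq_bigr => i _ do rewrite /perm_height card_set_sum.
rewrite exchange_big /=; apply: eq_bigr => a _.
by rewrite -card_set_sum; apply: card_ord_itv; apply: ltnW.
Qed.

Lemma card_inversions_from s i : avoids321 s ->
  #|[set j : 'I_n | (i < j) && (s j < s i)]| = s i - i.
Proof.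
move=> av; have [lti|lei] := ltnP i (s i); last first.
  rewrite (eqnP lei); apply: eq_card0 => j; rewrite inE; apply/negP => /andP[ltij ltji].
  by have := avoids321_inversion_excpos av ltij ltji; rewrite ltnNge lei.
rewrite -{2}(card_perm_ltn s (ltnW (ltn_ord (s i)))) -{2}(card_ord_ltn (ltnW (ltn_ord i))).
rewrite -cardsDS.
  apply: eq_card => j; rewrite !inE -leqNgt [i <= j]leq_eqVlt.
  by case: eqP => [/val_inj->|] //=; rewrite !ltnn.
apply/subsetP => j; rewrite !inE => ltji; rewrite perm_ltnNge //.
by apply/negP => /(avoids321_inversion_antiexc av ltji); lia.
Qed.

Lemma invnum_height s : avoids321 s -> invnum s = \sum_(i < n) perm_height s i.+1.
Proof.
move=> av; rewrite sum_perm_height /invnum card_set_sum.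
rewrite -(pair_bigA _ (fun i j => ((i < j) && (s j < s i) : nat))) /=.
by apply: eq_bigr => i _; rewrite -card_set_sum card_inversions_from.
Qed.

Lemma excnum_le_invnum s : avoids321 s -> excnum s <= invnum s.
Proof.
move=> av; rewrite invnum_height // excnum_sum.
by apply: leq_sum => i _; apply: excpos_le_heightS.
Qed.

(* Before [i], [a] has at least as many positions as [b] has values up to [i], so
   matching them increasingly moves a position [i] of [a] to the right; counting
   complements shows that no other position moves to the right. *)
Lemma excpos_colour_increasing (a b : pred 'I_n) s :
  (forall i, count_below b i.+1 <= count_below a i) ->
  (forall i, b (s i) = a i) -> colour_increasing a s -> excpos s =1 a.
Proof.
move=> dom bs incr i; rewrite /excpos.
have := dom i; have := colour_count_perm i bs incr.
rewrite !colour_count_bool ?(ltnW (ltn_ord _)) //.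
case: (boolP (a i)) => ai eqc lec; first apply: contraT.
  rewrite -leqNgt => lesi.
  by have := @ltn_count_below _ b (s i) i.+1; rewrite bs ai ltnS => /(_ isT lesi); lia.
apply/negbTE/negP => /(leq_count_below (predC b)).
have := count_belowC b (ltn_ord i); have := count_belowC b (ltnW (ltn_ord (s i))).
have := count_belowC a (ltnW (ltn_ord i)); lia.
Qed.

End Avoiding321.

Section Words.

(* The path encoding of a permutation draws an arc from each excedance to its
   value; the letter [(a, b)] records whether an arc opens and whether one closes
   at a position. *)
Definition letter := (bool * bool)%type.

(* Truncation only occurs for a letter [(false, true)] at height [0], which
   neither a valid word nor a word of nonzero weight contains. *)
Definition next_height (h : nat) (x : letter) := h + x.1 - x.2.

Definition height_at (w : seq letter) i := foldl next_height 0 (take i w).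

Variable n : nat.
Implicit Types (w : n.-tuple letter) (s : 'S_n).

Definition opens w : pred 'I_n := fun i => (tnth w i).1.
Definition closes w : pred 'I_n := fun i => (tnth w i).2.

Definition valid_word w :=
  [forall i, closes w i ==> (0 < height_at w i)] && (height_at w n == 0).

Lemma height_at0 (w : seq letter) : height_at w 0 = 0.
Proof. by rewrite /height_at take0. Qed.

Lemma height_atS w (i : 'I_n) : height_at w i.+1 = height_at w i + opens w i - closes w i.
Proof.
rewrite /height_at (take_nth (false, false)) ?size_tuple // foldl_rcons.
by rewrite -tnth_nth.
Qed.

Lemma count_opens w m : valid_word w -> m <= n ->
  count_below (opens w) m = count_below (closes w) m + height_at w m.
Proof.
case/andP=> /forallP pos _; elim: m => [|m IHm] ltmn.
  by rewrite !count_below0 height_at0.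
have /= -> := height_atS w (Ordinal ltmn).
rewrite !(count_belowS _ (Ordinal ltmn)) (IHm (ltnW ltmn)).
have /= := implyP (pos (Ordinal ltmn)).
by case: (closes w _) => [/(_ isT)|_]; case: (opens w _) => /=; lia.
Qed.

Lemma count_closesS_le w (i : 'I_n) : valid_word w ->
  count_below (closes w) i.+1 <= count_below (opens w) i.
Proof.
move=> vw; rewrite count_belowS (count_opens vw) ?(ltnW (ltn_ord i)) // leq_add2l.
have /andP[/forallP/(_ i)/implyP pos _] := vw.
by case: (closes w i) pos => // /(_ isT).
Qed.

Definition perm_word s : n.-tuple letter := [tuple (excpos s i, excval s i) | i < n].

Lemma opens_perm_word s : opens (perm_word s) =1 excpos s.
Proof. by move=> i; rewrite /opens tnth_mktuple. Qed.

Lemma closes_perm_word s : closes (perm_word s) =1 excval s.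
Proof. by move=> i; rewrite /closes tnth_mktuple. Qed.

Lemma height_perm_word s m : m <= n -> height_at (perm_word s) m = perm_height s m.
Proof.
elim: m => [|m IHm] ltmn; first by rewrite perm_height0 height_at0.
have /= -> := height_atS (perm_word s) (Ordinal ltmn).
rewrite (IHm (ltnW ltmn)) opens_perm_word closes_perm_word.
by have /= := perm_heightS s (Ordinal ltmn) => <-; rewrite addnK.
Qed.

Lemma valid_perm_word s : valid_word (perm_word s).
Proof.
rewrite /valid_word height_perm_word // perm_height_max eqxx andbT.
apply/forallP => i; apply/implyP; rewrite closes_perm_word => /excval_height_gt0.
by rewrite height_perm_word // ltnW.
Qed.

Lemma perm_word_inj : {in @avoids321 n &, injective perm_word}.
Proof.
move=> s s' /avoids321P incr /avoids321P incr' eqw.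
have eqpos : excpos s =1 excpos s' by move=> i; rewrite -!opens_perm_word eqw.
have eqval : excval s =1 excval s' by move=> i; rewrite -!closes_perm_word eqw.
apply: (colour_increasing_inj (excval_perm s) _ incr) => [i|i j ltij].
  by rewrite eqval excval_perm eqpos.
by rewrite !eqpos; apply: incr'.
Qed.

Lemma perm_word_surj w : valid_word w ->
  exists2 s : 'S_n, avoids321 s & perm_word s = w.
Proof.
move=> vw; have /andP[_ /eqP height_n] := vw.
have [x|s closes_s incr] := @colour_increasing_exists _ _ (opens w) (closes w).
  by rewrite !colour_count_bool // count_opens // height_n addn0.
have pos_opens : excpos s =1 opens w.
  by apply: excpos_colour_increasing closes_s incr => i; apply: count_closesS_le.
have val_closes : excval s =1 closes w.
  by move=> i; rewrite -[i](permKV s) excval_perm pos_opens closes_s.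
exists s; first by apply/avoids321P => i j ltij; rewrite !pos_opens; apply: incr.
by apply: eq_from_tnth => i; rewrite tnth_mktuple pos_opens val_closes -surjective_pairing.
Qed.

End Words.

Local Open Scope ring_scope.

Lemma sum_ord_even (V : nmodType) (F : nat -> V) n :
  (forall k, F k.*2.+1 = 0) -> \sum_(k < n.*2.+1) F k = \sum_(k < n.+1) F k.*2.
Proof.
move=> F_odd; elim: n => [|n IHn]; first by rewrite !big_ord1.
by rewrite doubleS 2!big_ord_recr [RHS]big_ord_recr /= F_odd addr0 IHn.
Qed.

Section WeightedPaths.
Variable R : comNzRingType.
Implicit Types u l d c : nat -> R.

(* Total weight of the [n]-step Motzkin paths from height [h] down to [0]; up
   and level steps are weighted by their starting height, down steps by their
   final height. *)
Fixpoint motzkin u l d (n h : nat) : R :=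
  if n is m.+1 then
    u h * motzkin u l d m h.+1 + l h * motzkin u l d m h
    + (if h is k.+1 then d k * motzkin u l d m k else 0)
  else (h == 0%N)%:R.

Definition dyck c := motzkin c (fun=> 0) (fun=> 1).

Lemma eq_motzkin u l d u' l' d' :
  u =1 u' -> l =1 l' -> d =1 d' -> motzkin u l d =2 motzkin u' l' d'.
Proof.
move=> eq_u eq_l eq_d; elim=> [|n IHn] h //=.
by rewrite eq_u eq_l !IHn; case: h => [//|h]; rewrite eq_d IHn.
Qed.

Lemma motzkin_scale x u l d n h :
  motzkin (fun k => x * u k) (fun k => x * l k) (fun k => x * d k) n h =
  x ^+ n * motzkin u l d n h.
Proof.
elim: n h => [|n IHn] [|h]; rewrite ?mul1r //= !IHn exprS; ring.
Qed.

Lemma motzkin_unit_down u l d n h :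
  motzkin u l d n h =
  (\prod_(i < h) d i) * motzkin (fun k => u k * d k) l (fun=> 1) n h.
Proof.
elim: n h => [|n IHn] [|h] /=; rewrite ?mulr0 ?big_ord0 ?mul1r //.
  by rewrite !IHn big_ord_recr !big_ord0 /=; ring.
by rewrite !IHn !big_ord_recr /=; ring.
Qed.

(* A path that starts above the axis is cut where it first reaches it. *)
Lemma motzkin_first_passage u l d n h :
  motzkin u l d n.+1 h.+1 =
  d 0%N * \sum_(k < n.+1)
    motzkin (u \o succn) (l \o succn) (d \o succn) k h * motzkin u l d (n - k) 0.
Proof.
elim: n h => [|n IHn] h.
  by rewrite big_ord1 /= !mulr0 !add0r mulr1; case: h => [|h]; rewrite ?mulr0.
set M' := motzkin (u \o succn) _ _ in IHn *; set M := motzkin u l d in IHn *.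
have -> : M n.+2 h.+1 = u h.+1 * M n.+1 h.+2 + l h.+1 * M n.+1 h.+1 + d h * M n.+1 h by [].
have M'0 j : M' 0%N j = (j == 0%N)%:R by [].
have M'S0 k : M' k.+1 0%N = u 1%N * M' k 1%N + l 1%N * M' k 0%N by rewrite /M' /= addr0.
have M'SS k j : M' k.+1 j.+1 =
    u j.+2 * M' k j.+2 + l j.+2 * M' k j.+1 + d j.+1 * M' k j by [].
rewrite big_ord_recl subn0; under eq_bigr => k _ do rewrite lift0 subSS.
case: h => [|h]; rewrite !IHn.
  under [in RHS]eq_bigr => k _ do rewrite M'S0 mulrDl -!mulrA.
  by rewrite big_split -!big_distrr /= M'0 /=; ring.
under [in RHS]eq_bigr => k _ do rewrite M'SS !mulrDl -!mulrA.
by rewrite !big_split -!big_distrr /= M'0 /=; ring.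
Qed.

Lemma dyckS0 c n : dyck c n.+1 0 = c 0%N * dyck c n 1.
Proof. by rewrite /dyck /= mul0r !addr0. Qed.

Lemma dyckSS c n h :
  dyck c n.+1 h.+1 = c h.+1 * dyck c n h.+2 + dyck c n h.
Proof. by rewrite /dyck /= mul0r addr0 mul1r. Qed.

Lemma dyck_odd_eq0 c n h : odd (n + h) -> dyck c n h = 0.
Proof.
elim: n h => [|n IHn] [|h] // odd_nh.
  by rewrite dyckS0 IHn ?mulr0 //; lia.
by rewrite dyckSS !IHn ?mulr0 ?addr0 //; lia.
Qed.

Lemma dyck_even_contraction c n h :
  dyck c n.*2 h.*2 =
  motzkin (fun k => c k.*2 * c k.*2.+1)
          (fun k => c k.*2 + (if k is j.+1 then c j.*2.+1 else 0))
          (fun=> 1) n h.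
Proof.
elim: n h => [|n IHn] [|h] //.
  rewrite /= -(IHn 0%N) -(IHn 1%N) doubleS dyckS0 dyckSS.
  by rewrite -[(0%N).*2]/0%N -[(1%N).*2]/2%N; ring.
rewrite /= -!IHn !doubleS !dyckSS; ring.
Qed.

Lemma dyck_odd_contraction c n h :
  dyck c n.*2.+1 h.*2.+1 =
  motzkin (fun k => c k.*2.+1 * c k.*2.+2)
          (fun k => c k.*2 + c k.*2.+1) (fun=> 1) n h.
Proof.
elim: n h => [|n IHn] h.
  by rewrite dyckSS [dyck c _ _.+2]/dyck /= mulr0 add0r; case: h.
rewrite /= -!IHn !doubleS; case: h => [|h].
  by rewrite dyckSS dyckSS dyckS0 -[(0%N).*2]/0%N; ring.
by rewrite -IHn !doubleS !dyckSS; ring.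
Qed.

Lemma dyck_scale x c n :
  dyck (fun k => x * c k) n.*2 0 = x ^+ n * dyck c n.*2 0.
Proof.
rewrite !(dyck_even_contraction _ n 0) -motzkin_scale.
rewrite [RHS]motzkin_unit_down big_ord0 mul1r; apply: eq_motzkin => // k; first by ring.
by case: k => [|k]; ring.
Qed.

Lemma dyck_doubleS c n :
  dyck c n.+1.*2 0 =
  c 0%N * \sum_(k < n.+1) dyck (c \o succn) k.*2 0 * dyck c (n - k).*2 0.
Proof.
rewrite doubleS dyckS0 [dyck c _ 1]motzkin_first_passage mul1r -!/(dyck _).
congr (_ * _); under [RHS]eq_bigr => k _ do rewrite doubleB.
apply: (sum_ord_even (F := fun k => dyck (c \o succn) k 0 * dyck c (n.*2 - k) 0)) => k.
by rewrite dyck_odd_eq0 ?mul0r // addn0 /= odd_double.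
Qed.

End WeightedPaths.

Section ContinuedFraction.
Variables (R : comNzRingType) (t q : R).

(* The coefficient of [z^n] in the tail [G_j] of the fraction. *)
Definition cf_coef (j n : nat) : R := nth (fun=> 0) (cf_table t q n) n j.

Lemma size_cf_table n : size (cf_table t q n) = n.+1.
Proof. by elim: n => //= n IHn; rewrite size_rcons IHn. Qed.

Lemma nth_cf_table n k j : (k <= n)%N ->
  nth (fun=> 0) (cf_table t q n) k j = cf_coef j k.
Proof.
elim: n => [|n IHn]; first by case: k.
rewrite leq_eqVlt => /predU1P[->//|ltkn].
by rewrite /= nth_rcons size_cf_table ltkn IHn.
Qed.

Lemma cf_coefS j n :
  cf_coef j n.+1 = cfc t q j * \sum_(k < n.+1) cf_coef j.+1 k * cf_coef j (n - k).
Proof.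
rewrite {1}/cf_coef /= nth_rcons size_cf_table ltnn eqxx big_distrr /=.
apply: eq_bigr => k _; rewrite -mulrA.
by rewrite !nth_cf_table ?leq_subr // -ltnS.
Qed.

Lemma cf_coef_dyck j n : cf_coef j n = dyck (fun k => cfc t q (j + k)) n.*2 0.
Proof.
elim/ltn_ind: n j => -[//|n] IHn j.
rewrite cf_coefS dyck_doubleS addn0; congr (_ * _); apply: eq_bigr => k _.
rewrite !IHn ?ltnS ?leq_subr ?leq_ord //.
by congr (_ * _); apply: eq_motzkin => // i /=; rewrite addnS addSn.
Qed.

Lemma Ctq_dyck n : Ctq t q n = dyck (fun k => cfc t q k.+1) n.*2 0.
Proof. exact: cf_coef_dyck. Qed.

Lemma cfc_doubleS k : cfc t q k.*2.+1 = q ^+ k.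
Proof. by rewrite /cfc /= odd_double uphalf_double. Qed.

Lemma cfc_doubleSS k : cfc t q k.*2.+2 = t * q ^+ k.
Proof. by rewrite /cfc /= odd_double /= doubleK. Qed.

(* The two summands are the weights of the two kinds of level steps off the axis. *)
Definition level_weight (y : R) h := if h is k.+1 then t * q ^+ k + q ^+ h else y.

Definition avoids321_motzkin (y : R) n :=
  motzkin (fun h => t * q ^+ h) (level_weight y) (fun h => q ^+ h) n 0.

Lemma Ctq_avoids321_motzkin n : Ctq t q n = avoids321_motzkin 1 n.
Proof.
rewrite Ctq_dyck [RHS]motzkin_unit_down big_ord0 mul1r (dyck_even_contraction _ n 0).
apply: eq_motzkin => // h; first by rewrite cfc_doubleS cfc_doubleSS; ring.
by case: h => [|h]; rewrite ?cfc_doubleS ?cfc_doubleSS ?addr0 // addrC.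
Qed.

End ContinuedFraction.

Lemma Carlitz_dyck (R : comNzRingType) (q : R) n :
  Carlitz q n = dyck (fun k => q ^+ k) n.*2 0.
Proof.
rewrite /Carlitz Ctq_dyck; apply: eq_motzkin => // k.
rewrite -(odd_double_half k); case: (odd k) => /=.
  by rewrite add1n cfc_doubleSS -exprM mul2n exprS.
by rewrite add0n cfc_doubleS -exprM mul2n.
Qed.

Section SignedDyck.
Variables (R : comNzRingType) (q : R).

Lemma dyck_signed n :
  dyck (fun k => - q ^+ k.*2.+1) n 0 =
  if odd n then 0 else (- q) ^+ n./2 * Carlitz (q ^+ 2) n./2.
Proof.
case: ifP => odd_n; first by rewrite dyck_odd_eq0 // addn0.
rewrite Carlitz_dyck -dyck_scale even_halfK ?odd_n //.
by apply: eq_motzkin => // k; rewrite -exprM mul2n mulNr exprS.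
Qed.

Lemma Ctq_Nm1 n : (0 < n)%N ->
  Ctq (-1) q n = if odd n then (- q) ^+ n.-1./2 * Carlitz (q ^+ 2) n.-1./2 else 0.
Proof.
case: n => // n _; rewrite Ctq_dyck doubleS dyckS0 (dyck_odd_contraction _ n 0).
rewrite (cfc_doubleS _ _ 0) mul1r /= if_neg -dyck_signed.
apply: eq_motzkin => // h; last by rewrite cfc_doubleS cfc_doubleSS; ring.
by rewrite cfc_doubleSS -doubleS cfc_doubleS mulN1r mulNr -exprD; congr (- q ^+ _); lia.
Qed.

Lemma derangement_motzkin_Nm1 n :
  avoids321_motzkin (-1 * q) q 0 n =
  if odd n then 0 else (- q) ^+ n./2 * Carlitz (q ^+ 2) n./2.
Proof.
rewrite /avoids321_motzkin motzkin_unit_down big_ord0 mul1r -dyck_signed.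
apply: eq_motzkin => // h; last by case: h => // h; rewrite /= exprS; ring.
by rewrite !mulN1r !mulNr -exprS -exprD; congr (- q ^+ _); lia.
Qed.

End SignedDyck.

Lemma sum_tupleS (V : nmodType) (T : finType) n (F : n.+1.-tuple T -> V) :
  \sum_w F w = \sum_x \sum_(w : n.-tuple T) F (cons_tuple x w).
Proof.
rewrite pair_big /= (reindex (fun p : T * n.-tuple T => cons_tuple p.1 p.2)) //.
exists (fun w => (thead w, behead_tuple w)) => [[x w] _ | w _] /=.
  by congr pair; apply: val_inj.
by rewrite [RHS]tuple_eta; apply: val_inj.
Qed.

Section WordWeight.
Variables (R : comNzRingType) (t q y : R).

Definition letter_weight (x : letter) (h : nat) : R :=
  match x, h with
  | (true, false), _ => t * q ^+ h
  | (true, true), k.+1 => t * q ^+ k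
  | (false, true), k.+1 => q ^+ k
  | (_, true), 0 => 0
  | (false, false), 0 => y
  | (false, false), _.+1 => q ^+ h
  end.

Fixpoint word_weight (h : nat) (w : seq letter) : R :=
  if w is x :: w' then letter_weight x h * word_weight (next_height h x) w'
  else (h == 0%N)%:R.

Lemma sum_word_weight n h :
  \sum_(w : n.-tuple letter) word_weight h w =
  motzkin (fun k => t * q ^+ k) (level_weight t q y) (fun k => q ^+ k) n h.
Proof.
elim: n h => [|n IHn] h.
  rewrite (eq_bigr (fun=> (h == 0%N)%:R)); last by move=> w _; rewrite tuple0.
  by rewrite sumr_const card_tuple expn0.
rewrite sum_tupleS /=.
under eq_bigr => x _ do rewrite -big_distrr /= IHn.
set M := motzkin _ _ _.
transitivity (\sum_a \sum_b letter_weight (a, b) h * M n (next_height h (a, b))).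
  by rewrite pair_bigA; apply: eq_bigr => -[].
rewrite !big_bool /next_height /= !addn0 !subn0 addn1.
rewrite /M; case: h => [|h] /=; first by ring.
by rewrite !subn1 /=; ring.
Qed.

Lemma word_weight_prod n h (w : n.-tuple letter) :
  word_weight h w =
  (\prod_(i < n) letter_weight (tnth w i) (foldl next_height h (take i w)))
  * (foldl next_height h w == 0%N)%:R.
Proof.
elim: n h w => [|n IHn] h w; first by rewrite tuple0 big_ord0 mul1r.
case/tupleP: w => x w; rewrite /= IHn big_ord_recl -!mulrA; congr (_ * (_ * _)).
by apply: eq_bigr => i _; rewrite tnthS.
Qed.

Variable n : nat.
Implicit Types (w : n.-tuple letter) (s : 'S_n).

Lemma word_weight0_prod w :
  word_weight 0 w =
  (\prod_(i < n) letter_weight (tnth w i) (height_at w i)) * (height_at w n == 0%N)%:R.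
Proof. by rewrite word_weight_prod {2}/height_at take_oversize ?size_tuple. Qed.

Lemma word_weight_invalid w : ~~ valid_word w -> word_weight 0 w = 0.
Proof.
rewrite word_weight0_prod negb_and => /orP[/forallPn[i]|/negPf->]; last by rewrite mulr0.
rewrite negb_imply -eqn0Ngt /closes => /andP[closes_i /eqP height0].
rewrite (bigD1 i) //= height0.
by case: (tnth w i) closes_i => [[] []] //= _; rewrite !mul0r.
Qed.

Lemma letter_weight_perm s (i : 'I_n) : avoids321 s ->
  letter_weight (excpos s i, excval s i) (perm_height s i) =
  y ^+ (s i == i) * t ^+ excpos s i * q ^+ (perm_height s i.+1 - excpos s i).
Proof.
move=> av; rewrite fixed_height //.
have := perm_heightS s i; have := @excval_height_gt0 _ s i.
case: (excpos s i); case: (excval s i) => /= height_gt0; rewrite ?addn0 ?addn1.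
- by case: (perm_height s i) height_gt0 => [/(_ isT)//|h] _ [->]; rewrite mul1r expr1 subn1.
- by move=> ->; rewrite mul1r expr1 subn1.
- by case: (perm_height s i) height_gt0 => [/(_ isT)//|h] _ [->]; rewrite !mul1r subn0.
by move=> ->; case: (perm_height s i) => [|h] /=; rewrite ?mulr1 ?mul1r ?subn0 ?mulr1.
Qed.

Lemma word_weight_perm s : avoids321 s ->
  word_weight 0 (perm_word s) =
  y ^+ fixnum s * t ^+ excnum s * q ^+ (invnum s - excnum s).
Proof.
move=> av; rewrite word_weight0_prod height_perm_word // perm_height_max eqxx mulr1.
under eq_bigr => i _ do
  rewrite tnth_mktuple height_perm_word ?(ltnW (ltn_ord i)) // letter_weight_perm //.
rewrite !big_split /= -!expr_sum /fixnum card_set_sum excnum_sum; congr (_ * _ ^+ _).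
by rewrite invnum_height // sumnB // => i _; apply: excpos_le_heightS.
Qed.

Lemma sum_avoids321 :
  \sum_(s : 'S_n | avoids321 s)
     y ^+ fixnum s * t ^+ excnum s * q ^+ (invnum s - excnum s) =
  avoids321_motzkin t q y n.
Proof.
rewrite /avoids321_motzkin -sum_word_weight (bigID (@valid_word n)) /=.
rewrite [X in _ + X]big1 ?addr0; last exact: word_weight_invalid.
rewrite (eq_bigr _ (fun s av => esym (word_weight_perm av))).
rewrite -(big_imset (fun w : n.-tuple letter => word_weight 0 w)); last exact: perm_word_inj.
apply: eq_bigl => w; apply/imsetP/idP => [[s _ ->]|/perm_word_surj[s av <-]].
  exact: valid_perm_word.
by exists s.
Qed.

End WordWeight.

Section Avoiding321Sums.
Variables (R : comNzRingType) (t q : R) (n : nat).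

Lemma Ctq_sum_avoids321 :
  Ctq t q n = \sum_(s : 'S_n | avoids321 s) t ^+ excnum s * q ^+ (invnum s - excnum s).
Proof.
rewrite Ctq_avoids321_motzkin -sum_avoids321.
by apply: eq_bigr => s _; rewrite expr1n mul1r.
Qed.

Lemma sum_derangement321 :
  \sum_(s : 'S_n | avoids321 s && derangement s) t ^+ excnum s * q ^+ invnum s =
  avoids321_motzkin (t * q) q 0 n.
Proof.
rewrite -sum_avoids321 big_mkcondr; apply: eq_bigr => s av.
rewrite derangement_fixnum expr0n; case: eqP => _; last by rewrite !mul0r.
by rewrite mul1r exprMn -mulrA -exprD subnKC // excnum_le_invnum.
Qed.

End Avoiding321Sums.

Theorem theorem1p4 (R : comNzRingType) (q : R) (n : nat) (hn : (1 <= n)%N) :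
  [/\ Ctq (-1) q n
        = \sum_(s : 'S_n | avoids321 s) (-1) ^+ excnum s * q ^+ (invnum s - excnum s),
      \sum_(s : 'S_n | avoids321 s) (-1) ^+ excnum s * q ^+ (invnum s - excnum s)
        = (if odd n then (- q) ^+ (n.-1)./2 * Carlitz (q ^+ 2) (n.-1)./2 else 0)
    & \sum_(s : 'S_n | avoids321 s && derangement s) (-1) ^+ excnum s * q ^+ invnum s
        = (if odd n then 0 else (- q) ^+ n./2 * Carlitz (q ^+ 2) n./2)].
Proof.
split.
- exact: Ctq_sum_avoids321.
- by rewrite -Ctq_sum_avoids321 Ctq_Nm1.
- by rewrite sum_derangement321 derangement_motzkin_Nm1.
Qed.
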